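(* Let $\Omega_c$ be a commutative semigroup and let $(A,(\prec_\omega)_{\omega\in\Omega_c},(\succ_\omega)_{\omega\in\Omega_c},\Omega_c)$ be a pre-anti-flexible family algebra. For all $\alpha,\beta\in\Omega_c$ and $x,y\in A$ define $$x\ast_{\alpha,\beta}y = x\succ_\alpha y + x\prec_\beta y .$$ Then the operations $(\ast_{\alpha,\beta})_{(\alpha,\beta)\in\Omega_c^2}$ define an $\Omega_c$-relative anti-flexible algebra structure on $A$.
   Context: Standing conventions: $\Omega_c$ is a commutative associative semigroup (written multiplicatively); $A$ is a finite-dimensional vector space over a field of characteristic zero; all operations on $A$ are bilinear. A pre-anti-flexible family algebra $(A,\prec_\omega,\succ_\omega,\Omega_c)$ is a vector space $A$ with bilinear operations $\prec_\alpha,\succ_\alpha:A\times A\to A$ for each $\alpha\in\Omega_c$ such that for all $x,y,z\in A$ and $\alpha,\beta\in\Omega_c$: $$(x\succ_\alpha y)\prec_\beta z - x\succ_\alpha(y\prec_\beta z) = (z\succ_\beta y)\prec_\alpha x - z\succ_\beta(y\prec_\alpha x),$$ $$(x\succ_\alpha y + x\prec_\beta y)\succ_{\alpha\beta}z - x\succ_\alpha(y\succ_\beta z) = (z\prec_\beta y)\prec_\alpha x - z\prec_{\beta\alpha}(y\succ_\beta x + y\prec_\alpha x).$$ An $\Omega_c$-relative anti-flexible algebra is a vector space $A$ with bilinear operations $\cdot_{\alpha,\beta}:A\times A\to A$ for each $(\alpha,\beta)\in\Omega_c^2$ such that for all $x,y,z\in A$ and $\alpha,\beta,\gamma\in\Omega_c$,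 $(x,y,z)_{\alpha,\beta,\gamma}=(z,y,x)_{\gamma,\beta,\alpha}$, where $(x,y,z)_{\alpha,\beta,\gamma}:=(x\cdot_{\alpha,\beta}y)\cdot_{\alpha\beta,\gamma}z - x\cdot_{\alpha,\beta\gamma}(y\cdot_{\beta,\gamma}z)$. *)

(* Defs.v *)
From HB Require Import structures.
From mathcomp Require Import all_boot all_algebra.

Set Implicit Arguments.
Unset Strict Implicit.
Unset Printing Implicit Defensive.

Import GRing.Theory.
Local Open Scope ring_scope.

(* A commutative semigroup is a type Omega with a law
   mul : SemiGroup.com_law Omega; it has no unit and Omega may be infinite. *)

Section FamilyAlgebras.

Variables (Omega : Type) (mul : SemiGroup.com_law Omega).
Variables (K : fieldType) (A : lmodType K).

Section PreAntiFlexible.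

Variables prec succ : Omega -> A -> A -> A.

Local Notation "x '\prec_(' a ) y" := (prec a x y)
  (at level 40, a at level 99, left associativity).
Local Notation "x '\succ_(' a ) y" := (succ a x y)
  (at level 40, a at level 99, left associativity).

Record pre_anti_flexible_family_algebra : Prop := PreAntiFlexible {
  prec_bilinear : forall a, bilinear_for *:%R *:%R (prec a);
  succ_bilinear : forall a, bilinear_for *:%R *:%R (succ a);
  succ_prec_flexible : forall (a b : Omega) (x y z : A),
    (x \succ_(a) y) \prec_(b) z - x \succ_(a) (y \prec_(b) z)
    = (z \succ_(b) y) \prec_(a) x - z \succ_(b) (y \prec_(a) x);
  succ_succ_flexible : forall (a b : Omega) (x y z : A),
    (x \succ_(a) y + x \prec_(b) y) \succ_(mul a b) z - x \succ_(a) (y \succ_(b) z)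
    = (z \prec_(b) y) \prec_(a) x - z \prec_(mul b a) (y \succ_(b) x + y \prec_(a) x)
}.

Definition star (a b : Omega) (x y : A) : A := x \succ_(a) y + x \prec_(b) y.

End PreAntiFlexible.

Section RelativeAntiFlexible.

(* op a b x y is x \cdot_{a,b} y. *)
Variable op : Omega -> Omega -> A -> A -> A.

Definition relative_associator (a b c : Omega) (x y z : A) : A :=
  op (mul a b) c (op a b x y) z - op a (mul b c) x (op b c y z).

Record relative_anti_flexible_algebra : Prop := RelativeAntiFlexible {
  op_bilinear : forall a b, bilinear_for *:%R *:%R (op a b);
  associator_flexible : forall (a b c : Omega) (x y z : A),
    relative_associator a b c x y z = relative_associator c b a z y x
}.

End RelativeAntiFlexible.

End FamilyAlgebras.

(* Main.v *)
Require Import Defs.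
From mathcomp Require Import all_boot all_algebra.

Import GRing.Theory.
Local Open Scope ring_scope.

(* After expanding the star-associator of (x, y, z) by additivity, it is the sum
   of the left-hand sides of the two axioms at (x, y, z) and of the right-hand
   side of the second axiom at (z, y, x). Rewriting with both axioms thus turns
   it into the star-associator of (z, y, x). *)

Section Star.

Context {Omega : Type} {mul : SemiGroup.com_law Omega}.
Context {K : fieldType} {A : lmodType K}.
Context {prec succ : Omega -> A -> A -> A}.
Context (preA : pre_anti_flexible_family_algebra mul prec succ).

Lemma star_bilinear a b : bilinear_for *:%R *:%R (star prec succ a b).
Proof.
have [precl precr] := prec_bilinear preA b.
have [succl succr] := succ_bilinear preA a.
split=> u k x y; rewrite /star.
- by rewrite precl succl /= scalerDr addrACA.
- by rewrite precr succr /= scalerDr addrACA.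
Qed.

(** The stars under [succ (mul a b)] and [prec (mul b c)] stay folded, as the second axiom contains
    these sums whole; only [prec c] and [succ a] get distributed. *)
Lemma star_associatorE a b c x y z :
  relative_associator mul (star prec succ) a b c x y z =
    (succ (mul a b) (star prec succ a b x y) z - succ a x (succ b y z)) +
    (prec c (succ a x y) z - succ a x (prec c y z)) +
    (prec c (prec b x y) z - prec (mul b c) x (star prec succ b c y z)).
Proof.
have precDl : prec c (star prec succ a b x y) z =
    prec c (succ a x y) z + prec c (prec b x y) z.
  have [precl _] := prec_bilinear preA c.
  (* Linearity at the scalar 1 is additivity. *)
  by have := precl z 1 (succ a x y) (prec b x y); rewrite /= !scale1r.
have succDr : succ a x (star prec succ b c y z) =
    succ a x (succ b y z) + succ a x (prec c y z).
  have [_ succr] := succ_bilinear preA a.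
  by have := succr x 1 (succ b y z) (prec c y z); rewrite /= !scale1r.
rewrite /relative_associator {1 3}/star precDl succDr !opprD.
by rewrite [X in X + _ = _]addrA addrACA; congr (_ + _); rewrite addrACA.
Qed.

End Star.

Theorem theorem2p4 (Omega : Type) (mul : SemiGroup.com_law Omega)
    (K : fieldType) (charK0 : [pchar K] =i pred0) (A : vectType K)
    (prec succ : Omega -> A -> A -> A) :
  pre_anti_flexible_family_algebra mul prec succ ->
  relative_anti_flexible_algebra mul (star prec succ).
Proof.
move=> preA; split=> [a b|a b c x y z]; first exact: (star_bilinear preA).
rewrite !(star_associatorE preA).
rewrite (succ_succ_flexible preA a b) (succ_prec_flexible preA a c).
(* Read backwards at [c b], the second axiom matches only the block with outer [prec c]; the three
   blocks for (z, y, x) then stand in reverse order. *)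
by rewrite -(succ_succ_flexible preA c b) addrC addrA addrAC.
Qed.
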